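(* There exist an infinite set of points $P\subset\mathbb{R}^2$ and a graph $H$ with vertex set $V(H)=P$ that satisfy the following properties. 1. The distance between any two distinct points of $P$ is at least $1/3$. 2. For any point $x\in\mathbb{R}^2$ there is a vertex $p\in P$ with $d(x,p)\le 1/3$. 3. For any two vertices $p,q\in P$ we have $d(p,q)\le d_H(p,q)$, and $d_H(p,q)=d(p,q)+O\left(\frac{d(p,q)}{\log^{2/3}(d(p,q))}\right)$; that is, there is a constant $K$ such that $d_H(p,q)\le d(p,q)+K\,\frac{d(p,q)}{(\log d(p,q))^{2/3}}$ for all $p,q\in P$ with $d(p,q)\ge 2$.
   Context: $d(p,q)$ is the Euclidean distance. Graphs are simple and unweighted; $d_H(p,q)$ is the graph distance, i.e. the minimum number of edges along a path connecting $p$ and $q$ in $H$ ($\infty$ if there is none). *)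

(* Defs.v *)
From HB Require Import structures.
From mathcomp Require Import all_boot all_order all_algebra.
From mathcomp Require Import all_classical all_reals all_analysis.
Set Implicit Arguments.
Unset Strict Implicit.
Unset Printing Implicit Defensive.
Import Order.TTheory GRing.Theory Num.Theory.
Local Open Scope classical_set_scope.
Local Open Scope ring_scope.

(* The norm that the library puts on [R * R] is the sup norm, hence the
   explicit formula. *)
Definition eucl_dist (R : realType) (p q : R * R) : R :=
  Num.sqrt ((p.1 - q.1) ^+ 2 + (p.2 - q.2) ^+ 2).

(* A simple graph whose vertex set, possibly infinite, is a subset of [T]. *)
Record sgraph (T : Type) := SGraph {
  vertices : set T;
  adj : rel T;
  adj_sym : symmetric adj;
  adj_irr : irreflexive adj;
  adj_vertices : forall x y, adj x y -> vertices x /\ vertices y }.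

(* The numbers of edges of the paths from [p] to [q]; the vertices of a path
   [p :: s] are pairwise distinct, and it has [size s] edges. *)
Definition path_lengths (T : eqType) (H : sgraph T) (p q : T) : set nat :=
  [set n | exists s : seq T,
     [/\ path (adj H) p s, uniq (p :: s), last p s = q & size s = n]].

(* The infimum of a nonempty set of natural numbers is its minimum, and the
   infimum of the empty set is [+oo]. *)
Definition graph_dist (R : realType) (T : eqType) (H : sgraph T) (p q : T) :
    \bar R :=
  ereal_inf [set n%:R%:E | n in path_lengths H p q].

(* Main.v *)
(* P is a maximal 1/3-separated set containing "rows" of unit-spaced points, and
   H joins the points of P at distance at most 1, so d <= d_H; as P is
   1/3-covering, d_H <= 3 d + 3 always.

   Class k consists of equally spaced parallel rows in a direction u_k; the
   directions of the classes n <= k < 2 n, n a power of 2, are 1/n-dense. The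
   points of class k that are within rad k of a point kept in a higher class are
   removed, with rad k increasing so fast that a stretch of about k^2 row gaps of
   class k is shorter than rad (k+1). Hence all points that disturb a stretch are
   on one row of one higher class. Such a row may be nearly parallel to u_k, but
   cutting the stretch into about k runs it disturbs two adjacent rows of
   class k in at most 3 consecutive runs; in the other runs one of the two rows
   is intact. So a path along u_k has relative error O(1/k).

   A pair at distance d >= rad (2 n + 1) is thus joined by a path of length
   d + O(d / n) along a single class n <= k < 2 n, the angular error being O(1/n)
   as well. As rad k is about 8^k (k!)^2, the largest such n has
   log d = O(n^(3/2)), which is the claimed bound. *)
Require Import Defs.
From mathcomp Require Import all_boot all_order all_algebra.
From mathcomp Require Import all_classical all_reals all_analysis.
From mathcomp Require Import ring lra zify.
Set Implicit Arguments.
Unset Strict Implicit.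
Unset Printing Implicit Defensive.
Import Order.TTheory GRing.Theory Num.Theory.
Local Open Scope classical_set_scope.
Local Open Scope ring_scope.

(** * Euclidean distance *)

Lemma eucl_distC (R : realType) (x y : R * R) : eucl_dist x y = eucl_dist y x.
Proof. by rewrite /eucl_dist; congr Num.sqrt; ring. Qed.

Lemma eucl_dist_ge0 (R : realType) (x y : R * R) : 0 <= eucl_dist x y.
Proof. exact: sqrtr_ge0. Qed.

Lemma eucl_distxx (R : realType) (x : R * R) : eucl_dist x x = 0.
Proof. by rewrite /eucl_dist !subrr expr0n addr0 sqrtr0. Qed.

Lemma sqr_eucl_dist (R : realType) (x y : R * R) :
  eucl_dist x y ^+ 2 = (x.1 - y.1) ^+ 2 + (x.2 - y.2) ^+ 2.
Proof. by rewrite sqr_sqrtr // addr_ge0 ?sqr_ge0. Qed.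

Lemma eucl_dist_le (R : realType) (x y : R * R) (r : R) : 0 <= r ->
  (eucl_dist x y <= r) = ((x.1 - y.1) ^+ 2 + (x.2 - y.2) ^+ 2 <= r ^+ 2).
Proof.
by move=> r0; rewrite -sqr_eucl_dist ler_sqr ?nnegrE // eucl_dist_ge0.
Qed.

Lemma eucl_dist_ge (R : realType) (x y : R * R) (r : R) : 0 <= r ->
  (r <= eucl_dist x y) = (r ^+ 2 <= (x.1 - y.1) ^+ 2 + (x.2 - y.2) ^+ 2).
Proof.
by move=> r0; rewrite -sqr_eucl_dist ler_sqr ?nnegrE // eucl_dist_ge0.
Qed.

Lemma eucl_dist_eq0 (R : realType) (x y : R * R) : eucl_dist x y <= 0 -> x = y.
Proof.
rewrite eucl_dist_le // expr0n /= => xy.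
have /eqP : (x.1 - y.1) ^+ 2 + (x.2 - y.2) ^+ 2 = 0.
  by apply/eqP; rewrite eq_le xy addr_ge0 ?sqr_ge0.
rewrite paddr_eq0 ?sqr_ge0 // !sqrf_eq0 !subr_eq0 => /andP[/eqP x1 /eqP x2].
by rewrite [x]surjective_pairing [y]surjective_pairing x1 x2.
Qed.

Lemma eucl_dist_triangle (R : realType) (y x z : R * R) :
  eucl_dist x z <= eucl_dist x y + eucl_dist y z.
Proof.
have xy0 := eucl_dist_ge0 x y; have yz0 := eucl_dist_ge0 y z.
rewrite eucl_dist_le ?addr_ge0 // [leRHS]sqrrD !sqr_eucl_dist.
set a := x.1 - y.1; set b := x.2 - y.2; set c := y.1 - z.1; set d := y.2 - z.2.
have -> : x.1 - z.1 = a + c by rewrite /a /c; ring.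
have -> : x.2 - z.2 = b + d by rewrite /b /d; ring.
(* This is the Cauchy-Schwarz inequality; it follows from Lagrange's identity below. *)
suff : a * c + b * d <= eucl_dist x y * eucl_dist y z by lra.
apply: le_trans (ler_norm _) _.
rewrite -ler_sqr ?nnegrE ?mulr_ge0 // real_normK ?num_real //.
rewrite exprMn !sqr_eucl_dist -/a -/b -/c -/d -subr_ge0.
have -> : (a ^+ 2 + b ^+ 2) * (c ^+ 2 + d ^+ 2) - (a * c + b * d) ^+ 2 =
  (a * d - b * c) ^+ 2 by ring.
exact: sqr_ge0.
Qed.

Lemma eucl_dist_fst (R : realType) (x y : R * R) :
  `|x.1 - y.1| <= eucl_dist x y.
Proof. by rewrite eucl_dist_ge // real_normK ?num_real // lerDl sqr_ge0. Qed.

(** * Graph distance in unit disk graphs *)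

Definition disk_adj (R : realType) (P : set (R * R)) : rel (R * R) :=
  fun x y => `[< [/\ P x, P y, x <> y & eucl_dist x y <= 1] >].

Lemma disk_adj_sym (R : realType) (P : set (R * R)) : symmetric (disk_adj P).
Proof.
move=> x y; apply/asboolP/asboolP => -[Px Py xy d];
  by split; rewrite // 1?eucl_distC //; apply: nesym.
Qed.

Lemma disk_adj_irr (R : realType) (P : set (R * R)) : irreflexive (disk_adj P).
Proof. by move=> x; apply/asboolP => -[]. Qed.

Lemma disk_adj_vertices (R : realType) (P : set (R * R)) (x y : R * R) :
  disk_adj P x y -> P x /\ P y.
Proof. by case/asboolP. Qed.

Definition disk_graph (R : realType) (P : set (R * R)) : sgraph (R * R)%type :=
  SGraph (@disk_adj_sym R P) (@disk_adj_irr R P) (@disk_adj_vertices R P).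

(** Walks may repeat vertices and [n] is only an upper bound, so that [reach] composes and weakens
    freely; [graph_dist_le_reach] passes to a simple path. *)
Definition reach (R : realType) (P : set (R * R)) (n : nat) (p q : R * R) :=
  exists s, [/\ path (disk_adj P) p s, last p s = q & (size s <= n)%N].

Lemma eucl_dist_path (R : realType) (P : set (R * R)) (p : R * R) s :
  path (disk_adj P) p s -> eucl_dist p (last p s) <= (size s)%:R.
Proof.
elim: s p => [|x s IHs] p /=; first by rewrite eucl_distxx.
case/andP=> /asboolP[_ _ _ px] /IHs xs.
by apply: le_trans (eucl_dist_triangle x _ _) _; rewrite -natr1 addrC lerD.
Qed.

Lemma graph_dist_ge (R : realType) (P : set (R * R)) (p q : R * R) :
  ((eucl_dist p q)%:E <= graph_dist R (disk_graph P) p q)%E.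
Proof.
apply: le_ereal_inf_tmp => _ [n [s [ps _ <- <-]] <-].
by rewrite lee_fin; apply: eucl_dist_path ps.
Qed.

Lemma graph_dist_le_reach (R : realType) (P : set (R * R)) n (p q : R * R) :
  reach P n p q -> (graph_dist R (disk_graph P) p q <= n%:R%:E)%E.
Proof.
case=> s [ps sq sn]; case: (shortenP ps) sq => s' ps' us' ss' s'q.
apply: (@le_trans _ _ (size s')%:R%:E).
  by apply: ereal_inf_lbound; exists (size s') => //; exists s'.
rewrite lee_fin ler_nat (leq_trans _ sn) // uniq_leq_size //.
by case/andP: us'.
Qed.

Lemma reach_refl (R : realType) (P : set (R * R)) n (p : R * R) : reach P n p p.
Proof. by exists [::]. Qed.

Lemma reach_leq (R : realType) (P : set (R * R)) m n (p q : R * R) :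
  (m <= n)%N -> reach P m p q -> reach P n p q.
Proof. by move=> mn [s [ps sq sm]]; exists s; split; rewrite // (leq_trans sm). Qed.

Lemma reach_trans (R : realType) (P : set (R * R)) (q p r : R * R) m n :
  reach P m p q -> reach P n q r -> reach P (m + n) p r.
Proof.
case=> s [ps sq sm] [t [qt tr tn]]; exists (s ++ t).
by rewrite cat_path ps last_cat sq qt size_cat leq_add.
Qed.

Lemma reach_sym (R : realType) (P : set (R * R)) n (p q : R * R) :
  reach P n p q -> reach P n q p.
Proof.
case=> s [ps sq sn]; exists (rev (belast p s)).
rewrite -sq rev_path size_rev size_belast; split => //.
  by rewrite (eq_path (e' := disk_adj P)) // => x y; rewrite disk_adj_sym.
by case: s {ps sq sn} => //= x s; rewrite rev_cons last_rcons.
Qed.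

Lemma reach_step (R : realType) (P : set (R * R)) (p q : R * R) :
  P p -> P q -> eucl_dist p q <= 1 -> reach P 1 p q.
Proof.
move=> Pp Pq pq; have [->|npq] := pselect (p = q); first exact: reach_refl.
by exists [:: q]; split => //=; rewrite andbT; apply/asboolP; split.
Qed.

(** * Separated and covering sets *)

Definition separated (R : realType) (P : set (R * R)) :=
  forall p q, P p -> P q -> p <> q -> 1 / 3 <= eucl_dist p q.

Definition covering (R : realType) (P : set (R * R)) :=
  forall x : R * R, exists2 p, P p & eucl_dist x p <= 1 / 3.

(** A maximal separated set is covering, since an uncovered point could be added. Zorn's lemma is
    applied to the sets whose union with [S] is separated, so that the empty chain causes no
    trouble. *)
Lemma separated_covering_ext (R : realType) (S : set (R * R)) :
  separated S -> exists P, [/\ S `<=` P, separated P & covering P].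
Proof.
move=> sepS.
have [F Fsep Ftot|A [sepA Amax]] :=
    @Zorn_bigcup (R * R)%type [set A | separated (A `|` S)].
  move=> p q [[A FA Ap]|Sp] [[B FB Bq]|Sq].
  - have [AB|BA] := Ftot _ _ FA FB.
      by apply: (Fsep _ FB); left => //; apply: AB.
    by apply: (Fsep _ FA); left => //; apply: BA.
  - by apply: (Fsep _ FA); [left|right].
  - by apply: (Fsep _ FB); [right|left].
  - exact: sepS.
exists (A `|` S); split => // x; apply: contrapT => far.
have {}far p : (A `|` S) p -> 1 / 3 <= eucl_dist x p.
  by move=> Ap; rewrite leNgt; apply/negP => /ltW xp; apply: far; exists p.
have nAx : ~ A x.
  by move=> Ax; have := far x (or_introl Ax); rewrite eucl_distxx; lra.
apply: (Amax (x |` A)); first by split; [move=> p Ap; right|move/(_ x (or_introl erefl))].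
move=> p q; rewrite -setUA => -[->|Ap] [->|Aq] pq //.
- exact: far.
- by rewrite eucl_distC; apply: far.
- exact: sepA.
Qed.

Lemma covering_infinite (R : realType) (P : set (R * R)) :
  covering P -> infinite_set P.
Proof.
move=> covP; have /choice[f fP] (n : nat) :
    exists p, P p /\ eucl_dist (n%:R, 0) p <= 1 / 3.
  by have [p Pp np] := covP (n%:R, 0); exists p.
(* A common value at [m] and [n] would give [|m - n| <= 2 / 3]. *)
have finj : injective f.
  move=> m n fmn; have [_ dm] := fP m; have [_] := fP n; rewrite -fmn => dn.
  have mn1 := eucl_dist_fst ((m%:R, 0) : R * R) (n%:R, 0).
  have mn2 := eucl_dist_triangle (f m) (m%:R, 0) (n%:R, 0).
  rewrite (eucl_distC (f m)) /= in mn1 mn2.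
  have : `|m%:R - n%:R : R| < 1 by lra.
  rewrite ltr_norml ltrBlDr => /andP[]; rewrite ltrBrDr addrC ltrBlDr.
  by rewrite !(natr1, nat1r) !ltr_nat; lia.
have /injfunPex[g] : exists2 g : nat -> R * R, set_fun setT P g & set_inj setT g.
  by exists f => [n _|m n _ _ /finj //]; have [] := fP n.
exact/infiniteP/(inj_card_le g).
Qed.

(** The point [x] slides along the segment to [q] in steps of at most [1 / 3], and the walk follows
    it through points of [P] within [1 / 3] of it. Consecutive ones are at distance at most 1, so
    every edge gains [1 / 3]. *)
Lemma reach_near (R : realType) (P : set (R * R)) (covP : covering P)
    (n : nat) (x p q : R * R) :
  P p -> P q -> eucl_dist p x <= 1 / 3 -> eucl_dist x q <= n.+1%:R / 3 ->
  reach P n.+1 p q.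
Proof.
move=> Pp Pq; elim: n x p Pp => [|n IHn] x p Pp px xq.
  by apply: reach_step => //; have := eucl_dist_triangle x p q; lra.
have [y xy yq] : exists2 y, eucl_dist x y <= 1 / 3 & eucl_dist y q <= n.+1%:R / 3.
  set t : R := n.+2%:R^-1.
  have t0 : 0 < t by rewrite invr_gt0 ltr0n.
  have tn : n.+2%:R * t = 1 by rewrite divff // pnatr_eq0.
  have n1 : n.+1%:R * t = 1 - t by move: tn; rewrite -[n.+2%:R]natr1; lra.
  move: xq; rewrite eucl_dist_le ?divr_ge0 // => xq.
  exists (x.1 + t * (q.1 - x.1), x.2 + t * (q.2 - x.2));
    rewrite eucl_dist_le ?divr_ge0 //=.
  - have := ler_wpM2l (sqr_ge0 t) xq.
    have -> : t ^+ 2 * (n.+2%:R / 3) ^+ 2 = (1 / 3) ^+ 2 * (n.+2%:R * t) ^+ 2 by field.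
    by rewrite tn expr1n mulr1; lra.
  - have := ler_wpM2l (sqr_ge0 (1 - t)) xq.
    have -> : (1 - t) ^+ 2 * (n.+2%:R / 3) ^+ 2 =
        (n.+1%:R / 3) ^+ 2 * (n.+2%:R * t) ^+ 2 by rewrite -n1; field.
    by rewrite tn expr1n mulr1; lra.
have [p' Pp' yp'] := covP y.
have pp' : eucl_dist p p' <= 1.
  have := eucl_dist_triangle x p p'; have := eucl_dist_triangle y x p'; lra.
rewrite -(add1n n.+1); apply: reach_trans (reach_step Pp Pp' pp') _.
by apply: (IHn y); rewrite // eucl_distC.
Qed.

Lemma reach_crude (R : realType) (P : set (R * R)) (covP : covering P)
    (r : nat) (p q : R * R) :
  P p -> P q -> eucl_dist p q <= r%:R -> reach P (3 * r) p q.
Proof.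
case: r => [|r] Pp Pq pq; first by rewrite (eucl_dist_eq0 pq); apply: reach_refl.
rewrite (_ : 3 * r.+1 = (3 * r).+2.+1)%N; last by lia.
apply: (reach_near covP (x := p)) => //; first by rewrite eucl_distxx; lra.
by rewrite (_ : (3 * r).+3 = 3 * r.+1)%N ?natrM; [lra|lia].
Qed.

(** * Grids and layers *)

Fixpoint rad (k : nat) : nat :=
  if k is k'.+1 then (8 * k'.+2 ^ 2 * rad k')%N else 1%N.

(** With the factor 4, points within [rad k] of two adjacent rows differ by more than [2 * rad k]
    across the rows, whereas points within [rad k] of the same row differ by less. *)
Definition gap (k : nat) : nat := (4 * rad k)%N.

Definition run (k : nat) : nat := (k.+2 * gap k)%N.

Lemma radS k : rad k.+1 = (8 * k.+2 ^ 2 * rad k)%N. Proof. by []. Qed.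

Lemma rad_gt0 k : (0 < rad k)%N.
Proof. by elim: k => // k IHk; rewrite radS !muln_gt0 IHk ?expn_gt0. Qed.

Lemma leq_rad j k : (j <= k)%N -> (rad j <= rad k)%N.
Proof.
elim: k => [|k IHk]; first by case: j.
rewrite leq_eqVlt ltnS => /predU1P[-> //|/IHk/leq_trans]; apply.
by rewrite radS leq_pmull // muln_gt0 ?expn_gt0.
Qed.

Lemma expn4_rad k : (4 ^ k <= rad k)%N.
Proof.
elim: k => // k IHk; rewrite radS expnS leq_mul // (@leq_trans 8) //.
by rewrite leq_pmulr // expn_gt0.
Qed.

(* Every stretch of [k.+2] runs, together with its surroundings, is shorter than
   the exclusion radius [rad j] of every class [j > k]. *)
Lemma run_rad k : (2 * (k.+2 * run k) = rad k.+1)%N.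
Proof. by rewrite radS /run /gap; lia. Qed.

(** Stereographic projection from [(-1, 0)]: [t] is the tangent of half the angle, and [[-1, 1]]
    parametrizes the right half circle. *)
Definition circle_pt (R : realType) (t : R) : R * R :=
  ((1 - t ^+ 2) / (1 + t ^+ 2), 2 * t / (1 + t ^+ 2)).

(* For [n] a power of two, the classes [n <= k < 2 * n] have [n] directions
   that are equally spaced in the parameter [t] of a half circle. *)
Definition dir (R : realType) (k : nat) : R * R :=
  let n := (2 ^ trunc_log 2 k)%N in
  circle_pt (2 * (k%:R - n%:R) / n%:R - 1).

Definition along (R : realType) (u z : R * R) : R := z.1 * u.1 + z.2 * u.2.

Definition across (R : realType) (u z : R * R) : R := z.2 * u.1 - z.1 * u.2.

(* The shift by one half keeps the grid of class [k] at distance at least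
   [gap k / 2] from the origin. *)
Definition node (R : realType) (k : nat) (a b : int) : R * R :=
  let u := dir R k in let h : R := (b%:~R + 1 / 2) * (gap k)%:R in
  (a%:~R * u.1 - h * u.2, a%:~R * u.2 + h * u.1).

Definition grid (R : realType) (k : nat) : set (R * R) :=
  [set x | exists a b, x = node R k a b].

Lemma circle_pt_unit (R : realType) (t : R) :
  (circle_pt t).1 ^+ 2 + (circle_pt t).2 ^+ 2 = 1.
Proof.
rewrite /circle_pt /=; field.
by rewrite gt_eqF // ltr_wpDr ?sqr_ge0.
Qed.

Lemma dir_unit (R : realType) k : (dir R k).1 ^+ 2 + (dir R k).2 ^+ 2 = 1.
Proof. exact: circle_pt_unit. Qed.

Lemma along_node (R : realType) k a b : along (dir R k) (node R k a b) = a%:~R.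
Proof.
have := dir_unit R k; rewrite /along /node /=; move: (dir R k) => [c s] /= cs.
by rewrite -[RHS]mulr1 -[X in _ = _ * X]cs; ring.
Qed.

Lemma across_node (R : realType) k a b :
  across (dir R k) (node R k a b) = (b%:~R + 1 / 2) * (gap k)%:R.
Proof.
have := dir_unit R k; rewrite /across /node /=; move: (dir R k) => [c s] /= cs.
by rewrite -[RHS]mulr1 -[X in _ = _ * X]cs; ring.
Qed.

Lemma sqr_eucl_dist_frame (R : realType) (u x y : R * R) :
  u.1 ^+ 2 + u.2 ^+ 2 = 1 ->
  eucl_dist x y ^+ 2 =
  (along u x - along u y) ^+ 2 + (across u x - across u y) ^+ 2.
Proof.
by move=> u1; rewrite sqr_eucl_dist -[LHS]mulr1 -u1 /along /across; ring.
Qed.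

Lemma along_le (R : realType) (u x y : R * R) : u.1 ^+ 2 + u.2 ^+ 2 = 1 ->
  `|along u x - along u y| <= eucl_dist x y.
Proof.
move=> u1; rewrite -ler_sqr ?nnegrE ?eucl_dist_ge0 // real_normK ?num_real //.
by rewrite (sqr_eucl_dist_frame _ _ u1) lerDl sqr_ge0.
Qed.

Lemma across_le (R : realType) (u x y : R * R) : u.1 ^+ 2 + u.2 ^+ 2 = 1 ->
  `|across u x - across u y| <= eucl_dist x y.
Proof.
move=> u1; rewrite -ler_sqr ?nnegrE ?eucl_dist_ge0 // real_normK ?num_real //.
by rewrite (sqr_eucl_dist_frame _ _ u1) lerDr sqr_ge0.
Qed.

Lemma eucl_dist_le_frame (R : realType) (u x y : R * R) :
  u.1 ^+ 2 + u.2 ^+ 2 = 1 ->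
  eucl_dist x y <= `|along u x - along u y| + `|across u x - across u y|.
Proof.
move=> u1; rewrite -ler_sqr ?nnegrE ?eucl_dist_ge0 ?addr_ge0 //.
rewrite (sqr_eucl_dist_frame _ _ u1) [leRHS]sqrrD !real_normK ?num_real //.
have : 0 <= `|along u x - along u y| * `|across u x - across u y|.
  by rewrite mulr_ge0.
by lra.
Qed.

Lemma eucl_dist_node (R : realType) k (a a' b b' : int) :
  eucl_dist (node R k a b) (node R k a' b') <=
  `|a%:~R - a'%:~R| + `|b%:~R - b'%:~R| * (gap k)%:R.
Proof.
apply: le_trans (eucl_dist_le_frame _ _ (dir_unit R k)) _.
rewrite !along_node !across_node -mulrBl normrM (ger0_norm (ler0n _ _)).
by rewrite (_ : b%:~R + 1 / 2 - (b'%:~R + 1 / 2) = b%:~R - b'%:~R :> R) //; ring.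
Qed.

Lemma int_dist_ge1 (R : realType) (a b : int) :
  a != b -> 1 <= `|a%:~R - b%:~R : R|.
Proof.
by move=> ab; rewrite -intrB -intr_norm -[1]/(1%:~R) ler_int; lia.
Qed.

Lemma eucl_dist_node_row (R : realType) k (a a' b b' : int) : b != b' ->
  (gap k)%:R <= eucl_dist (node R k a b) (node R k a' b').
Proof.
move=> /(int_dist_ge1 R) bb; apply: le_trans _ (across_le _ _ (dir_unit R k)).
rewrite !across_node -mulrBl normrM (ger0_norm (ler0n _ _)).
rewrite -[leLHS]mul1r ler_wpM2r //.
by rewrite (_ : b%:~R + 1 / 2 - (b'%:~R + 1 / 2) = b%:~R - b'%:~R :> R) //; ring.
Qed.

Lemma eucl_dist_node_ge1 (R : realType) k (a a' b b' : int) :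
  node R k a b <> node R k a' b' -> 1 <= eucl_dist (node R k a b) (node R k a' b').
Proof.
move=> neq; have [bb|bb] := eqVneq b b'; last first.
  apply: le_trans _ (eucl_dist_node_row R k a a' bb).
  by rewrite ler1n muln_gt0 rad_gt0.
have /(int_dist_ge1 R) aa : a != a' by apply: contra_notN neq => /eqP->; rewrite bb.
by apply: le_trans _ (along_le _ _ (dir_unit R k)); rewrite !along_node.
Qed.

Lemma grid_far (R : realType) k (x : R * R) :
  grid k x -> 2 * (rad k)%:R <= eucl_dist 0 x.
Proof.
move=> [a [b ->]]; apply: le_trans _ (across_le _ _ (dir_unit R k)).
rewrite across_node /across /= !mul0r subrr sub0r normrN normrM.
rewrite (ger0_norm (ler0n _ _)) /gap natrM mulrA ler_wpM2r //.
suff : 1 / 2 <= `|b%:~R + 1 / 2 : R| by lra.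
rewrite ler_normr.
have [b0|b0] := leP 0 b.
  by have : (0 : R) <= b%:~R; [rewrite ler0z|lra].
have : b%:~R <= -1 :> R by rewrite -[-1]/((-1)%:~R) ler_int; lia.
by lra.
Qed.

(** [K] is a kernel of the digraph [lt], defined by well-founded recursion. It settles which points
    are kept: whether a point is removed depends on which points of higher classes are kept, and
    there is no highest class to start from. *)
Lemma wf_kernel (T : Type) (lt : T -> T -> Prop) : well_founded lt ->
  exists K : set T, forall x, K x <-> ~ exists2 y, lt y x & K y.
Proof.
move=> wf.
pose F x (rec : forall y, lt y x -> Prop) := ~ exists y (yx : lt y x), rec y yx.
exists (Fix wf (fun=> Prop) F) => x; rewrite Fix_eq.
  by split=> nK [y]; [move=> yx Ky; apply: nK; exists y, yx|
                      move=> [yx Ky]; apply: nK; exists y].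
move=> {}x f g fg; rewrite /F; congr (~ _).
by apply/propext; split=> -[y [yx]] Ky; exists y, yx; rewrite ?fg // -fg.
Qed.

(** The last two fields are the independence and the absorption of a kernel of [blocks]: a point is
    removed exactly when a kept point of a higher class is too close. *)
Record layering (R : realType) (L : nat -> set (R * R)) : Prop := Layering {
  layer_grid : forall k, L k `<=` grid k;
  layer_far : forall j k x y, (k < j)%N -> L k x -> L j y ->
    (rad k)%:R <= eucl_dist x y;
  layer_max : forall k x, grid k x ->
    L k x \/ exists j y, [/\ (k < j)%N, L j y & eucl_dist x y < (rad k)%:R] }.

Definition blocks (R : realType) (s t : nat * (R * R)) : Prop :=
  [/\ (t.1 < s.1)%N, grid s.1 s.2, grid t.1 t.2 &
      eucl_dist t.2 s.2 < (rad t.1)%:R].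

(* Going from [t] to a blocking [s] at most doubles the distance to the origin,
   hence [|s.2| / 2 ^ s.1 <= |t.2| / 2 ^ t.1], whereas the points [x] of class [k]
   have [|x| >= 2 * 4 ^ k]. So the classes in a chain of blockings are bounded. *)
Lemma blocks_wf (R : realType) : well_founded (@blocks R).
Proof.
suff acc (B m k : nat) (x : R * R) : (B <= k + m)%N ->
    eucl_dist 0 x <= (B * 2 ^ k)%:R -> Acc (@blocks R) (k, x).
  move=> [k x]; pose B := Num.bound (eucl_dist 0 x).
  apply: (acc B B); first by rewrite leq_addl.
  apply: le_trans (ltW (archi_boundP (eucl_dist_ge0 0 x))) _.
  by rewrite ler_nat leq_pmulr // expn_gt0.
elim: m k x => [|m IHm] k x Bk xB; apply: Acc_intro => -[j y] [/= kj gy gx xy].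
all: have yB : eucl_dist 0 y <= (B * 2 ^ j)%:R.
1,3: apply: le_trans (eucl_dist_triangle x _ _) _;
  apply: (@le_trans _ _ ((B * 2 ^ k.+1)%:R));
  [rewrite expnS mulnCA natrM; have := grid_far gx; have := eucl_dist_ge0 0 x; lra
  |by rewrite ler_nat leq_mul2l leq_exp2l // kj orbT].
- have := le_trans (grid_far gy) yB; rewrite -natrM ler_nat leqNgt => /negP[].
  have : (B * 2 ^ j <= 2 ^ j * 2 ^ j)%N by have := @ltn_expl 2 j isT; nia.
  by have := expn4_rad j; have := rad_gt0 j; rewrite -expnMn -[(2 * 2)%N]/4%N; lia.
- by apply: IHm yB; lia.
Qed.

Lemma exists_layering (R : realType) : exists L : nat -> set (R * R), layering L.
Proof.
have [K KP] := wf_kernel (@blocks_wf R).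
exists (fun k => [set x | grid k x /\ K (k, x)]); split.
- by move=> k x [].
- move=> j k x y kj [gx /KP Kx] [gy Ky]; rewrite leNgt; apply/negP => xy.
  by apply: Kx; exists (j, y).
- move=> k x gx; have [Kx|/KP/contrapT[[j y] [/= kj gy _ xy] Ky]] := pselect (K (k, x)).
    by left.
  by right; exists j, y.
Qed.

Lemma layering_separated (R : realType) (L : nat -> set (R * R)) :
  layering L -> separated (\bigcup_k L k).
Proof.
move=> LL p q [j _ Lp] [k _ Lq] pq; apply: (@le_trans _ _ 1); first by lra.
have [jk|kj|jk] := ltngtP j k.
- by apply: le_trans (layer_far LL jk Lp Lq); rewrite ler1n rad_gt0.
- by rewrite eucl_distC; apply: le_trans (layer_far LL kj Lq Lp); rewrite ler1n rad_gt0.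
- move: (layer_grid LL Lp) (layer_grid LL Lq) pq; rewrite jk => -[a [b ->]] [c [d ->]].
  exact: eucl_dist_node_ge1.
Qed.

(** * Travelling along a row of a layer *)

Definition open_run (R : realType) (L : nat -> set (R * R)) k (a b : int) :=
  forall j, (j <= run k)%N -> L k (node R k (a + j%:Z) b).

Lemma blocked_run (R : realType) (L : nat -> set (R * R)) k (a b : int) :
  layering L -> ~ open_run L k a b -> let u := dir R k in
  exists l y, [/\ (k < l)%N, L l y,
    a%:~R - (rad k)%:R < along u y < a%:~R + (run k)%:R + (rad k)%:R &
    `|across u y - (b%:~R + 1 / 2) * (gap k)%:R| < (rad k)%:R].
Proof.
move=> LL /existsNP[j /not_implyP[jk nL]] u.
have gx : grid k (node R k (a + j%:Z) b) by exists (a + j%:Z), b.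
have [//|[l [y [kl Ly xy]]]] := layer_max LL gx.
exists l, y; split=> //.
- have := le_lt_trans (along_le _ _ (dir_unit R k)) xy.
  rewrite along_node intrD -pmulrn ltr_norml -/u => /andP[].
  have : j%:R <= (run k)%:R :> R by rewrite ler_nat.
  by have : (0 : R) <= j%:R by []; move=> *; lra.
- have := le_lt_trans (across_le _ _ (dir_unit R k)) xy.
  by rewrite across_node -/u distrC.
Qed.

(** Points of different classes above [k] are at least [rad k.+1] apart by [layer_far], and
    different rows of one such class are even further apart. *)
Lemma same_row (R : realType) (L : nat -> set (R * R)) k l l' y y' :
  layering L -> (k < l)%N -> (k < l')%N -> L l y -> L l' y' ->
  eucl_dist y y' < (rad k.+1)%:R ->
  forall a b, y = node R l a b -> exists a', y' = node R l a' b.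
Proof.
move=> LL kl kl' Ly Ly' yy' a b yab.
have far j : (k < j)%N -> ~ (rad j)%:R <= eucl_dist y y'.
  by move=> kj; apply/negP; rewrite -ltNge (lt_le_trans yy') // ler_nat leq_rad.
have [ll'|l'l|ll'] := ltngtP l l'.
- by have := layer_far LL ll' Ly Ly'; have := far _ kl.
- by have := layer_far LL l'l Ly' Ly; rewrite eucl_distC; have := far _ kl'.
- have [a' [b' y'ab]] := layer_grid LL Ly'; exists a'; rewrite y'ab -ll'.
  have [-> //|bb'] := eqVneq b b'; case: (far _ kl).
  rewrite yab y'ab -ll'; apply: le_trans (eucl_dist_node_row R l a a' bb').
  by rewrite ler_nat leq_pmull.
Qed.

(** By [same_row] all three points lie on one row, so the determinant of their differences vanishes
    in any frame. *)
Lemma blockers_collinear (R : realType) (L : nat -> set (R * R)) k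
    l1 l2 l3 y1 y2 y3 : layering L ->
  (k < l1)%N -> (k < l2)%N -> (k < l3)%N -> L l1 y1 -> L l2 y2 -> L l3 y3 ->
  eucl_dist y1 y2 < (rad k.+1)%:R -> eucl_dist y1 y3 < (rad k.+1)%:R ->
  forall u : R * R,
  (along u y2 - along u y1) * (across u y3 - across u y1) =
  (across u y2 - across u y1) * (along u y3 - along u y1).
Proof.
move=> LL k1 k2 k3 L1 L2 L3 y12 y13 u; have [a1 [b y1E]] := layer_grid LL L1.
have [a2 y2E] := same_row LL k1 k2 L1 L2 y12 y1E.
have [a3 y3E] := same_row LL k1 k3 L1 L3 y13 y1E.
by rewrite y1E y2E y3E /along /across /node /=; ring.
Qed.

(* The points blocking the two rows lie on one line. It climbs by about [gap k]
   within one run, so it has left both rows three runs further on. *)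
Lemma blocked_runs_close (R : realType) (L : nat -> set (R * R)) k (a b : int)
    (i i' : nat) : layering L -> (i' < k.+2)%N ->
  let start i := a + (i * run k)%:Z in
  ~ open_run L k (start i) b -> ~ open_run L k (start i) (b + 1) ->
  ~ open_run L k (start i') b -> (i' < i + 3)%N.
Proof.
move=> LL i'k start /(blocked_run LL)[l1 [y1 [kl1 Ly1 A1 B1]]].
move=> /(blocked_run LL)[l2 [y2 [kl2 Ly2 A2 B2]]].
move=> /(blocked_run LL)[l3 [y3 [kl3 Ly3 A3 B3]]].
rewrite ltnNge; apply/negP => ii'.
set u := dir R k in A1 B1 A2 B2 A3 B3.
have startE j : (start j)%:~R = a%:~R + j%:R * (run k)%:R :> R.
  by rewrite /start intrD -pmulrn natrM.
rewrite !startE in A1 A2 A3; move: A1 A2 A3 => /andP[A1 A1'] /andP[A2 A2'] /andP[A3 A3'].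
move: B1 B2 B3; rewrite intrD !ltr_norml => /andP[B1 B1'] /andP[B2 B2'] /andP[B3 B3'].
have rad1 : 1 <= (rad k)%:R :> R by rewrite ler1n rad_gt0.
have gapE : (gap k)%:R = 4 * (rad k)%:R :> R by rewrite natrM.
have runE : (run k)%:R = k.+2%:R * (4 * (rad k)%:R) :> R by rewrite natrM gapE.
have radE : (rad k.+1)%:R = 2 * (k.+2%:R * (run k)%:R) :> R by rewrite -run_rad !natrM.
have k2 : 2 <= k.+2%:R :> R by rewrite ler_nat.
have i0 : 0 <= i%:R :> R by [].
have i'k2 : i'%:R + 1 <= k.+2%:R :> R by rewrite natr1 ler_nat.
have ii'3 : i%:R + 3 <= i'%:R :> R by rewrite -natrD ler_nat.
have run8 : 8 * (rad k)%:R <= (run k)%:R :> R by rewrite runE; nra.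
rewrite gapE in B1 B1' B2 B2' B3 B3'.
move: B1 B1' B2 B2' B3 B3' A1 A1' A2 A2' A3 A3'.
move: (i%:R) (i'%:R) (k.+2%:R) (run k)%:R (rad k)%:R (b%:~R) (a%:~R)
  rad1 runE radE k2 i0 i'k2 ii'3 run8 => x x' n m r b0 a0.
move=> rad1 runE radE k2 i0 i'k2 ii'3 run8 B1 B1' B2 B2' B3 B3' A1 A1' A2 A2' A3 A3'.
have m0 : 0 < m by lra.
have d12 : eucl_dist y1 y2 < (rad k.+1)%:R.
  apply: le_lt_trans (eucl_dist_le_frame _ _ (dir_unit R k)) _; rewrite -/u radE.
  have : `|along u y1 - along u y2| < m + 2 * r by rewrite ltr_norml; lra.
  have : `|across u y1 - across u y2| < 6 * r by rewrite ltr_norml; lra.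
  have : 2 * m <= n * m by rewrite ler_pM2r.
  lra.
have d13 : eucl_dist y1 y3 < (rad k.+1)%:R.
  apply: le_lt_trans (eucl_dist_le_frame _ _ (dir_unit R k)) _; rewrite -/u radE.
  have : x' * m + m <= n * m by nra.
  have : 0 <= x * m by rewrite mulr_ge0 // ltW.
  have : x * m + 3 * m <= x' * m by nra.
  move=> h1 h2 h3.
  have : `|along u y1 - along u y3| < n * m + 2 * r by rewrite ltr_norml; lra.
  have : `|across u y1 - across u y3| < 2 * r by rewrite ltr_norml; lra.
  have : 2 * m <= n * m by rewrite ler_pM2r.
  lra.
(* From [y1] to [y2] the line is steep, from [y1] to [y3] it is flat. One product is below
   [2 * r * (m + 2 * r)], the other above [2 * r * (2 * m - 2 * r)], which is impossible for
   [m >= 8 * r]. *)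
have := blockers_collinear LL kl1 kl2 kl3 Ly1 Ly2 Ly3 d12 d13 u.
have h1 : x * m + 3 * m <= x' * m by nra.
have dB : 2 * r < across u y2 - across u y1 by lra.
have dA : 2 * m - 2 * r < along u y3 - along u y1 by lra.
have dA' : `|along u y2 - along u y1| < m + 2 * r by rewrite ltr_norml; lra.
have dB' : `|across u y3 - across u y1| < 2 * r by rewrite ltr_norml; lra.
move=> cross; have := ler_norm ((across u y2 - across u y1) * (along u y3 - along u y1)).
rewrite -cross normrM; apply/negP; rewrite -ltNge.
apply: (@le_lt_trans _ _ ((m + 2 * r) * (2 * r))).
  by rewrite ler_pM ?normr_ge0 // ltW.
by rewrite cross; nra.
Qed.

Lemma exists_waypoint (R : realType) (P : set (R * R)) (x : R * R) :
  covering P -> exists2 p, P p & eucl_dist p x <= 1 / 3.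
Proof. by move=> /(_ x)[p Pp xp]; exists p; rewrite // eucl_distC. Qed.

Lemma reach_open_run (R : realType) (L : nat -> set (R * R)) P k (a b : int) :
  layering L -> \bigcup_k L k `<=` P -> open_run L k a b ->
  reach P (run k) (node R k a b) (node R k (a + (run k)%:Z) b).
Proof.
move=> LL LP ab.
suff IH j : (j <= run k)%N -> reach P j (node R k a b) (node R k (a + j%:Z) b).
  exact: IH.
elim: j => [|j IHj] jk; first by rewrite addr0; apply: reach_refl.
rewrite -addn1; apply: reach_trans (IHj (ltnW jk)) _.
apply: reach_step; try by apply: LP; exists k => //; apply: ab; lia.
apply: le_trans (eucl_dist_node _ _ _ _ _ _) _.
rewrite subrr normr0 mul0r addr0 -intrB -intr_norm -[1]/(1%:~R) ler_int.
by rewrite -addn1 PoszD; lia.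
Qed.

(** The ends stay near row [b] even when row [b + 1] is used. Changing rows at both ends costs
    [3 * (gap k).+1] edges each, by [reach_crude]. *)
Lemma reach_run (R : realType) (L : nat -> set (R * R)) P k (a b : int) p q :
  layering L -> \bigcup_k L k `<=` P -> covering P -> P p -> P q ->
  eucl_dist p (node R k a b) <= 1 / 3 ->
  eucl_dist q (node R k (a + (run k)%:Z) b) <= 1 / 3 ->
  open_run L k a b \/ open_run L k a (b + 1) ->
  reach P (run k + 6 * (gap k).+1) p q.
Proof.
move=> LL LP covP Pp Pq pa qa op.
have [b' bb' {}op] : exists2 b', (`|b - b'| <= 1) & open_run L k a b'.
  by case: op => op; [exists b|exists (b + 1)] => //; lia.
have near a' r : eucl_dist r (node R k a' b) <= 1 / 3 ->
    eucl_dist r (node R k a' b') <= (gap k).+1%:R.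
  move=> ra; apply: le_trans (eucl_dist_triangle (node R k a' b) _ _) _.
  have := eucl_dist_node R k a' a' b b'; rewrite subrr normr0 add0r -natr1.
  have : `|b%:~R - b'%:~R : R| * (gap k)%:R <= 1 * (gap k)%:R.
    by rewrite ler_wpM2r // -intrB -intr_norm -[1]/(1%:~R) ler_int.
  lra.
have Pn a' : L k (node R k a' b') -> P (node R k a' b') by move=> ?; apply: LP; exists k.
have Pstart : P (node R k a b') by apply: Pn; rewrite -[a]addr0; apply: (op 0%N).
have Pend : P (node R k (a + (run k)%:Z) b') by apply: Pn; apply: op.
rewrite (_ : _ + _ = 3 * (gap k).+1 + run k + 3 * (gap k).+1)%N; last by lia.
apply: reach_trans (_ : reach P _ (node R k (a + (run k)%:Z) b') _).
  apply: reach_trans (reach_open_run LL LP op).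
  exact: reach_crude (near _ _ pa).
by apply/reach_sym; apply: reach_crude (near _ _ qa).
Qed.

Lemma reach_blocked_run (R : realType) P k (a b : int) (p q : R * R) :
  covering P -> P p -> P q ->
  eucl_dist p (node R k a b) <= 1 / 3 ->
  eucl_dist q (node R k (a + (run k)%:Z) b) <= 1 / 3 ->
  reach P (3 * (run k).+1) p q.
Proof.
move=> covP Pp Pq pa qa; apply: reach_crude => //; rewrite eucl_distC in qa.
have := eucl_dist_triangle (node R k a b) p q.
have := eucl_dist_triangle (node R k (a + (run k)%:Z) b) (node R k a b) q.
have := eucl_dist_node R k a (a + (run k)%:Z) b b.
rewrite subrr normr0 mul0r addr0 intrD opprD addNKr normrN -pmulrn.
rewrite normr_nat -natr1; lra.
Qed.

(** Row changes cost [6 * (gap k).+1] in each of [k.+2] runs, at most [12 * run k] together; at most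
    three blocked runs cost [2 * run k] extra each. One more edge makes 19 a sufficient factor. *)
Lemma reach_stretch (R : realType) (L : nat -> set (R * R)) P k (a b : int) p q :
  layering L -> \bigcup_k L k `<=` P -> covering P -> P p -> P q ->
  eucl_dist p (node R k a b) <= 1 / 3 ->
  eucl_dist q (node R k (a + (k.+2 * run k)%:Z) b) <= 1 / 3 ->
  reach P (k.+2 * run k + 19 * run k) p q.
Proof.
move=> LL LP covP Pp Pq pa.
pose start i := a + (i * run k)%:Z.
pose blocked i := ~ (open_run L k (start i) b \/ open_run L k (start i) (b + 1)).
(* [i0] is the first blocked run, if there is one; [blocked_runs_close] confines the others to the
   next two. *)
have [i0 i0P] : exists i0, forall i, (i < k.+2)%N -> blocked i -> (i0 <= i < i0 + 3)%N.
  have [[i1 [i1k bi1]]|nb] := pselect (exists i, (i < k.+2)%N /\ blocked i); last first.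
    by exists 0%N => i ik bi; case: nb; exists i.
  have ex : exists i, `[< (i < k.+2)%N /\ blocked i >] by exists i1; apply/asboolP.
  exists (ex_minn ex); case: ex_minnP => i /asboolP[ik bi] imin j jk bj.
  rewrite imin /=; last exact/asboolP.
  move: bi bj => /not_orP[i0' i1'] /not_orP[j0 _].
  exact: (blocked_runs_close LL jk i0' i1' j0).
(* The truncated [minn 3 (i - i0)] counts the runs before [i] among the three that may be
   blocked. *)
suff IH i r : (i <= k.+2)%N -> P r -> eucl_dist r (node R k (start i) b) <= 1 / 3 ->
    reach P (1 + i * (run k + 6 * (gap k).+1) + 2 * run k * minn 3 (i - i0)) p r.
  move=> /(IH _ _ (leqnn _) Pq); apply: reach_leq.
  have : (k.+2 <= run k)%N by rewrite leq_pmulr // muln_gt0 rad_gt0.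
  have : (k.+2 * gap k = run k)%N by [].
  have : (2 * run k * minn 3 (k.+2 - i0) <= 2 * run k * 3)%N by rewrite leq_mul2l geq_minl orbT.
  by rewrite mulnDr mulnCA mulnS; move: (k.+2 * run k)%N (minn _ _) => *; lia.
elim: i r => [|i IHi] r ik Pr ra.
  apply: (@reach_leq _ _ 1) => //; apply: reach_step => //.
  rewrite /start addr0 eucl_distC in ra.
  by have := eucl_dist_triangle (node R k a b) p r; lra.
have [z Pz za] := exists_waypoint (node R k (start i) b) covP.
have {IHi} := IHi z (ltnW ik) Pz za.
have {ra}ra : eucl_dist r (node R k (start i + (run k)%:Z) b) <= 1 / 3.
  by rewrite /start -addrA -PoszD -mulSnr.
have [bi|/contrapT op] := pselect (blocked i).
  move=> pz; have := reach_trans pz (reach_blocked_run covP Pz Pr za ra).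
  apply: reach_leq; have /andP[i0i ii0] := i0P i ik bi.
  have -> : (minn 3 (i.+1 - i0) = (minn 3 (i - i0)).+1)%N by lia.
  rewrite (mulSn i) (mulnS (2 * run k)); move: (i * _)%N (2 * run k * _)%N => *; lia.
move=> pz; have := reach_trans pz (reach_run LL LP covP Pz Pr za ra op).
apply: reach_leq.
have : (2 * run k * minn 3 (i - i0) <= 2 * run k * minn 3 (i.+1 - i0))%N.
  by rewrite leq_mul2l; apply/orP; right; lia.
rewrite (mulSn i); move: (i * _)%N (2 * run k * _)%N (2 * run k * _)%N => *; lia.
Qed.

Lemma reach_row (R : realType) (L : nat -> set (R * R)) P k (a b : int) p q m :
  layering L -> \bigcup_k L k `<=` P -> covering P -> P p -> P q ->
  eucl_dist p (node R k a b) <= 1 / 3 ->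
  eucl_dist q (node R k (a + (m * (k.+2 * run k))%:Z) b) <= 1 / 3 ->
  reach P (1 + m * (k.+2 * run k + 19 * run k)) p q.
Proof.
move=> LL LP covP Pp + pa; elim: m q => [|m IHm] q Pq qa.
  apply: reach_step => //; rewrite addr0 eucl_distC in qa.
  by have := eucl_dist_triangle (node R k a b) p q; lra.
have [z Pz za] := exists_waypoint (node R k (a + (m * (k.+2 * run k))%:Z) b) covP.
rewrite mulSnr addnA; apply: reach_trans (IHm z Pz za) _.
by apply: (reach_stretch LL LP covP Pz Pq za); rewrite -addrA -PoszD -mulSnr.
Qed.

(** * Choice of a direction *)

(** The squared chord is [4 * (s - t) ^+ 2] divided by [(1 + s ^+ 2) * (1 + t ^+ 2)], which is at
    least 1. *)
Lemma circle_pt_lipschitz (R : realType) (s t : R) :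
  eucl_dist (circle_pt s) (circle_pt t) <= 2 * `|s - t|.
Proof.
rewrite eucl_dist_le ?mulr_ge0 // exprMn real_normK ?num_real // /circle_pt /=.
have s0 : 0 < 1 + s ^+ 2 by rewrite ltr_wpDr ?sqr_ge0.
have t0 : 0 < 1 + t ^+ 2 by rewrite ltr_wpDr ?sqr_ge0.
set lhs := (X in X <= _).
have -> : lhs = 2 ^+ 2 * (s - t) ^+ 2 / ((1 + s ^+ 2) * (1 + t ^+ 2)).
  by rewrite /lhs; field; rewrite !gt_eqF.
rewrite ler_pdivrMr ?mulr_gt0 // ler_peMr //; first by rewrite -exprMn sqr_ge0.
by rewrite mulr_ege1 ?lerDl ?sqr_ge0.
Qed.

Lemma circle_pt_surj (R : realType) (v : R * R) :
  v.1 ^+ 2 + v.2 ^+ 2 = 1 -> 0 <= v.1 ->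
  exists t, [/\ -1 <= t, t <= 1 & v = circle_pt t].
Proof.
move: v => [c s] /= cs c0; exists (s / (1 + c)).
have c1 : 0 < 1 + c by lra.
split; [rewrite ler_pdivlMr //; nra|rewrite ler_pdivrMr //; nra|].
have tE : (s / (1 + c)) ^+ 2 = (1 - c) / (1 + c).
  rewrite expr_div_n (_ : s ^+ 2 = (1 - c) * (1 + c)); last by lra.
  by field; rewrite gt_eqF.
by rewrite /circle_pt tE; congr pair; field; rewrite gt_eqF //; lra.
Qed.

Lemma dir_dense (R : realType) e (v : R * R) :
  v.1 ^+ 2 + v.2 ^+ 2 = 1 -> 0 <= v.1 ->
  exists k, (2 ^ e <= k < 2 ^ e.+1)%N /\
    eucl_dist (dir R k) v <= 4 / (2 ^ e)%:R.
Proof.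
move=> v1 v0; have [t [t1 t1' ->]] := circle_pt_surj v1 v0.
set n := (2 ^ e)%N; have n0 : (0 < n)%N by rewrite expn_gt0.
have n0' : 0 < n%:R :> R by rewrite ltr0n.
have [r rn rt] : exists2 r, (r < n)%N & `|2 * r%:R / n%:R - 1 - t| <= 2 / n%:R.
  have s0 : 0 <= (t + 1) / 2 * n%:R by rewrite mulr_ge0 //; lra.
  have sn : (t + 1) / 2 * n%:R <= n%:R by rewrite ger_pMl //; lra.
  have tE : t = 2 * ((t + 1) / 2 * n%:R) / n%:R - 1 by field; rewrite gt_eqF.
  have main (r : nat) : r%:R <= (t + 1) / 2 * n%:R <= r%:R + 1 ->
      `|2 * r%:R / n%:R - 1 - t| <= 2 / n%:R.
    move=> /andP[r1 r2]; rewrite {1}tE.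
    rewrite (_ : _ - _ = (r%:R - (t + 1) / 2 * n%:R) * (2 / n%:R)); last first.
      by field; rewrite gt_eqF.
    rewrite normrM [X in _ * X]ger0_norm ?divr_ge0 // ger_pMl ?divr_gt0 //.
    by rewrite ler_norml; lra.
  have /andP[r1 r2] := truncn_itv s0.
  have [rn|nr] := ltnP (Num.truncn ((t + 1) / 2 * n%:R)) n.
    by exists (Num.truncn ((t + 1) / 2 * n%:R)) => //; apply: main; rewrite r1 natr1 ltW.
  (* Only [t = 1] remains, the right end of the last interval. *)
  exists n.-1; first by rewrite prednK.
  apply: main; rewrite natr1 prednK // sn andbT.
  have : n%:R <= (Num.truncn ((t + 1) / 2 * n%:R))%:R :> R by rewrite ler_nat.
  have : n.-1%:R <= n%:R :> R by rewrite ler_nat leq_pred.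
  lra.
exists (n + r)%N; have nr : (n <= n + r < 2 ^ e.+1)%N.
  by rewrite leq_addr expnS -/n; lia.
split=> //; rewrite /dir (trunc_log_eq _ nr) // -/n natrD [_ + r%:R]addrC addrK.
apply: le_trans (circle_pt_lipschitz _ _) _.
by rewrite (_ : 4 / _ = 2 * (2 / n%:R)) ?ler_wpM2l //; ring.
Qed.

Lemma exists_near_node (R : realType) k (x : R * R) :
  exists a b, eucl_dist x (node R k a b) <= (gap k)%:R + 1.
Proof.
have g0 : 0 < (gap k)%:R :> R by rewrite ltr0n muln_gt0 rad_gt0.
set A := along (dir R k) x; set B := across (dir R k) x.
exists (Num.floor A), (Num.floor (B / (gap k)%:R)).
apply: le_trans (eucl_dist_le_frame _ _ (dir_unit R k)) _.
rewrite along_node across_node addrC -/A -/B.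
have /andP[A1 A2] := floor_itv A; have /andP[B1 B2] := floor_itv (B / (gap k)%:R).
move: A1 A2 B1 B2; rewrite !intrD.
move: (Num.floor A)%:~R (Num.floor (B / (gap k)%:R))%:~R => a b A1 A2.
rewrite ler_pdivlMr // ltr_pdivrMr // => B1 B2.
by apply: lerD; rewrite ler_norml; lra.
Qed.

Lemma eucl_dist_line (R : realType) (p u : R * R) (s t : R) :
  u.1 ^+ 2 + u.2 ^+ 2 = 1 ->
  eucl_dist (p.1 + s * u.1, p.2 + s * u.2) (p.1 + t * u.1, p.2 + t * u.2) <=
  `|s - t|.
Proof.
move=> u1; rewrite eucl_dist_le // real_normK ?num_real //=.
by rewrite -[leRHS]mulr1 -[X in _ <= _ * X]u1; lra.
Qed.

Lemma eucl_dist_fan (R : realType) (p u v : R * R) (d : R) : 0 <= d ->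
  eucl_dist (p.1 + d * u.1, p.2 + d * u.2) (p.1 + d * v.1, p.2 + d * v.2) <=
  d * eucl_dist u v.
Proof.
move=> d0; rewrite eucl_dist_le ?mulr_ge0 ?eucl_dist_ge0 //= exprMn sqr_eucl_dist.
by lra.
Qed.

(** The three terms are the errors of the starting point, the length travelled and the angle; [p1]
    and [p2] separate them. *)
Lemma eucl_dist_node_shift (R : realType) k (a b : int) (m : nat)
    (p v : R * R) (d : R) : 0 <= d ->
  eucl_dist (node R k (a + m%:Z) b) (p.1 + d * v.1, p.2 + d * v.2) <=
  eucl_dist (node R k a b) p + `|m%:R - d| + d * eucl_dist (dir R k) v.
Proof.
move=> d0; set u := dir R k.
pose p1 : R * R := (p.1 + m%:R * u.1, p.2 + m%:R * u.2).
pose p2 : R * R := (p.1 + d * u.1, p.2 + d * u.2).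
apply: le_trans (eucl_dist_triangle p2 _ _) _; apply: lerD.
  apply: le_trans (eucl_dist_triangle p1 _ _) _; apply: lerD.
    rewrite le_eqVlt; apply/orP; left; apply/eqP; rewrite /eucl_dist /node /p1 /= -/u.
    by rewrite intrD -pmulrn; congr Num.sqrt; ring.
  exact/eucl_dist_line/dir_unit.
exact: eucl_dist_fan.
Qed.

(* One row carries the path up to the angular error [4 / n]. *)
Lemma reach_far (R : realType) (L : nat -> set (R * R)) P e (p q : R * R) :
  layering L -> \bigcup_k L k `<=` P -> covering P -> P p -> P q ->
  let n := (2 ^ e)%N in
  (rad (2 * n).+1)%:R <= eucl_dist p q -> p.1 <= q.1 ->
  exists m, reach P m p q /\
    m%:R <= eucl_dist p q + 60 * (eucl_dist p q / n%:R).
Proof.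
move=> LL LP covP Pp Pq n; set d := eucl_dist p q => dn pq1.
have n0 : (0 < n)%N by rewrite expn_gt0.
have n0' : 0 < n%:R :> R by rewrite ltr0n.
have d0 : 0 < d by apply: lt_le_trans dn; rewrite ltr0n rad_gt0.
pose v : R * R := ((q.1 - p.1) / d, (q.2 - p.2) / d).
have v1 : v.1 ^+ 2 + v.2 ^+ 2 = 1.
  have dE : (q.1 - p.1) ^+ 2 + (q.2 - p.2) ^+ 2 = d ^+ 2.
    by rewrite sqr_eucl_dist; ring.
  by rewrite /v /= !expr_div_n -mulrDl dE divff // expf_neq0 // gt_eqF.
have v0 : 0 <= v.1 by rewrite /v /= divr_ge0 ?subr_ge0 // ltW.
have [k [/andP[nk kn] kv]] := dir_dense e v1 v0; rewrite -/n in nk kn kv.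
have {kn}kn : (k < 2 * n)%N by rewrite expnS in kn.
have [a [b pab]] := exists_near_node k p.
pose len := (k.+2 * run k)%N.
(* As [2 * len <= rad (2 * n)], the factor [8 * (2 * n).+2 ^ 2] in [rad (2 * n).+1] leaves room for
   [n]. *)
have len_d : n%:R * len%:R <= d.
  apply: le_trans dn; rewrite -natrM ler_nat radS.
  have : (2 * len <= rad (2 * n))%N by rewrite run_rad leq_rad.
  have nn : (n <= (2 * n).+2 ^ 2)%N by rewrite -mulnn; nia.
  move=> len_rad; rewrite -mulnA (leq_trans _ (leq_pmull _ _)) // leq_mul //; lia.
have rg : (gap k <= len)%N by rewrite /len /run mulnA leq_pmull.
have g0 : (0 < gap k)%N by rewrite muln_gt0 rad_gt0.
have len0 : 0 < len%:R :> R by rewrite ltr0n (leq_trans g0).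
have /andP[m1 m2] := truncn_itv (divr_ge0 (ltW d0) (ltW len0)).
move: (Num.truncn _) m1 m2 => m; rewrite ler_pdivlMr // ltr_pdivrMr // -natr1 => m1 m2.
have [z Pz za] := exists_waypoint (node R k a b) covP.
have [z' Pz' za'] := exists_waypoint (node R k (a + (m * len)%:Z) b) covP.
have pz : eucl_dist p z <= (gap k).+2%:R.
  have := eucl_dist_triangle (node R k a b) p z; rewrite (eucl_distC (node R k a b)) -!natr1.
  lra.
have z'q : eucl_dist z' q <= (gap k)%:R + 2 + len%:R + 4 * (d / n%:R).
  apply: le_trans (eucl_dist_triangle (node R k (a + (m * len)%:Z) b) _ _) _.
  have := eucl_dist_node_shift k a b (m * len) p v (ltW d0).
  rewrite (_ : (_, _) = q); last first.
    by rewrite [RHS]surjective_pairing; congr pair; rewrite /v /=; field; rewrite gt_eqF.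
  have : d * eucl_dist (dir R k) v <= d * (4 / n%:R) by rewrite ler_pM2l.
  have : `|(m * len)%:R - d| <= len%:R by rewrite natrM ler_norml; lra.
  rewrite (_ : d * (4 / n%:R) = 4 * (d / n%:R)); last by ring.
  rewrite (eucl_distC (node R k a b)); lra.
set D : R := _ + _ in z'q.
have D0 : 0 <= D by apply: le_trans z'q; apply: eucl_dist_ge0.
have /andP[D1 D2] := truncn_itv D0.
(* The walk goes from [p] to the row, along [m] stretches of it, and on to [q] over a distance of at
   most [D]. As [gap k], [len] and 1 are at most [d / n], the excess is at most [56 * (d / n)]. *)
exists (3 * (gap k).+2 + (1 + m * (len + 19 * run k)) + 3 * (Num.truncn D).+1)%N; split.
  apply: reach_trans (reach_crude covP Pz' Pq (le_trans z'q (ltW D2))).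
  apply: reach_trans (reach_crude covP Pp Pz pz) _.
  exact: (reach_row LL LP covP Pz Pz' za za').
rewrite !natrD !natrM natrD -!natr1 mulrDr natrM.
have mrun : m%:R * (19 * (run k)%:R) <= 19 * (d / n%:R).
  rewrite mulrCA ler_wpM2l // ler_pdivlMr // -!natrM.
  apply: le_trans m1; rewrite -natrM ler_nat -mulnA leq_mul2l mulnC leq_mul2r.
  by rewrite (leq_trans nk) ?orbT // leqW // leqW.
have dn' : len%:R <= d / n%:R by rewrite ler_pdivlMr // mulrC.
have : 1 <= len%:R :> R by rewrite ler1n (leq_trans g0).
have : (gap k)%:R <= len%:R :> R by rewrite ler_nat.
move: D1; rewrite /D; lra.
Qed.

Lemma reach_main (R : realType) (L : nat -> set (R * R)) P (p q : R * R) :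
  layering L -> \bigcup_k L k `<=` P -> covering P -> P p -> P q ->
  2 <= eucl_dist p q ->
  exists n m, [/\ (0 < n)%N, eucl_dist p q < (rad (4 * n).+1)%:R, reach P m p q &
    m%:R <= eucl_dist p q + 60 * (eucl_dist p q / n%:R)].
Proof.
(* The directions cover only the right half circle, so the endpoints are ordered by abscissa. *)
move=> LL LP covP; wlog pq1 : p q / p.1 <= q.1 => [hw|] Pp Pq d2.
  have [pq|/ltW qp] := leP p.1 q.1; first exact: hw.
  rewrite eucl_distC in d2; have [n [m [n0 dn qpm mn]]] := hw q p qp Pq Pp d2.
  by exists n, m; rewrite eucl_distC; split=> //; apply: reach_sym.
have d0 := eucl_dist_ge0 p q.
have grow n : (rad (2 * n).+1)%:R <= (rad (4 * n).+1)%:R :> R.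
  by rewrite ler_nat leq_rad // ltnS leq_mul2r orbT.
have [d_lt|d_ge] := ltP (eucl_dist p q) (rad (2 * 2 ^ 0).+1)%:R.
  have /andP[t1 t2] := truncn_itv d0.
  (* For bounded distances [n = 1] and the crude path suffice. *)
  exists (2 ^ 0)%N, (3 * (Num.truncn (eucl_dist p q)).+1)%N; split.
  - by [].
  - exact: lt_le_trans d_lt (grow _).
  - exact: reach_crude (ltW t2).
  - rewrite natrM -natr1 divr1; lra.
have ex : exists e, (rad (2 * 2 ^ e).+1)%:R <= eucl_dist p q by exists 0%N.
have ub e : (rad (2 * 2 ^ e).+1)%:R <= eucl_dist p q ->
    (e <= Num.truncn (eucl_dist p q))%N.
  have /andP[_ t2] := truncn_itv d0.
  move=> /le_lt_trans/(_ t2); rewrite ltr_nat ltnS; apply: leq_trans.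
  have := expn4_rad (2 * 2 ^ e).+1; have := @ltn_expl 4 (2 * 2 ^ e).+1 isT.
  by have := @ltn_expl 2 e isT; lia.
(* Maximality of [e] gives the upper bound on the distance. *)
case: (ex_maxnP ex ub) => e de emax.
have [m [pqm mn]] := reach_far LL LP covP Pp Pq de pq1.
exists (2 ^ e)%N, m; split=> //; first by rewrite expn_gt0.
rewrite ltNge; apply/negP; rewrite (_ : 4 * 2 ^ e = 2 * 2 ^ e.+1)%N.
  by move=> /emax; rewrite ltnn.
by rewrite expnS mulnA.
Qed.

(** * Growth of the exclusion radii and the final bound *)

Lemma ln_rad_le (R : realType) k :
  ln (rad k)%:R <= 12 * k%:R * Num.sqrt k.+1%:R :> R.
Proof.
elim: k => [|k IHk]; first by rewrite ln1 mulr0 mul0r.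
set s := Num.sqrt k.+2%:R.
have s0 : 1 <= s by rewrite -[leLHS]sqrtr1 ler_wsqrtr // ler1n.
have ss : s ^+ 2 = k.+2%:R by rewrite sqr_sqrtr.
have ks : Num.sqrt k.+1%:R <= s by rewrite ler_wsqrtr // ler_nat.
rewrite -[k.+1%:R]natr1 radS 2!natrM natrX -ss -exprM lnM ?posrE ?mulr_gt0 ?exprn_gt0 //; try by lra.
  rewrite lnM ?posrE ?exprn_gt0 //; try by lra.
  rewrite lnXn; last by lra.
  (* The increment is [ln 8 + 4 * ln s < 8 + 4 * s <= 12 * s]. *)
  have := @ln_sublinear R 8 ltac:(by lra); have := @ln_sublinear R s ltac:(by lra).
  have : 12 * k%:R * Num.sqrt k.+1%:R <= 12 * k%:R * s by rewrite ler_wpM2l ?mulr_ge0.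
  rewrite -mulr_natl; lra.
by rewrite ltr0n rad_gt0.
Qed.

Lemma powR_ln_rad_le (R : realType) n (d : R) : (0 < n)%N -> 1 <= d ->
  d < (rad (4 * n).+1)%:R -> ln d `^ (2 / 3) <= 30 * n%:R.
Proof.
move=> n0 d1 dn; have n1 : 1 <= n%:R :> R by rewrite ler1n.
have l0 : 0 <= ln d by rewrite ln_ge0.
(* Here [4 * n + 1 <= 5 * n] and [4 * n + 2 <= 6 * n]. *)
have lnd : ln d <= 60 * n%:R * Num.sqrt (6 * n%:R).
  apply: le_trans (ltW _) (le_trans (ln_rad_le R (4 * n).+1) _).
    have d0 : 0 < d by lra.
    by rewrite ltr_ln ?posrE //; apply: lt_trans d0 dn.
  apply: ler_pM => //.
    by rewrite -!natrM ler_nat; lia.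
  by rewrite ler_wsqrtr // -natrM ler_nat; lia.
(* The constants compare as [60 ^ 2 * 6 = 21600 <= 27000 = 30 ^ 3]; a cube root then gives the
   claim. *)
have sq : ln d ^+ 2 <= (30 * n%:R) ^+ 3.
  apply: (@le_trans _ _ ((60 * n%:R * Num.sqrt (6 * n%:R)) ^+ 2)).
    by rewrite ler_sqr ?nnegrE // (le_trans l0).
  rewrite exprMn sqr_sqrtr ?mulr_ge0 //.
  have : 0 <= n%:R ^+ 3 :> R by rewrite exprn_ge0.
  lra.
rewrite (powRrM _ 2) powR_mulrn //.
apply: le_trans (ge0_ler_powR _ _ _ sq) _; rewrite ?nnegrE ?invr_ge0 ?exprn_ge0 ?mulr_ge0 //.
by rewrite -powR_mulrn ?mulr_ge0 // -powRrM divff // powRr1 // mulr_ge0.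
Qed.

Theorem theorem2 (R : realType) :
  exists (P : set (R * R)) (H : sgraph (R * R)%type),
    [/\ infinite_set P,
        vertices H = P,
        forall p q, P p -> P q -> p <> q -> 1 / 3 <= eucl_dist p q,
        forall x : R * R, exists2 p, P p & eucl_dist x p <= 1 / 3 &
        (forall p q, P p -> P q ->
           ((eucl_dist p q)%:E <= graph_dist R H p q)%E) /\
        exists K : R, forall p q, P p -> P q -> 2 <= eucl_dist p q ->
          (graph_dist R H p q <=
            (eucl_dist p q
             + K * (eucl_dist p q / (ln (eucl_dist p q) `^ (2 / 3))))%:E)%E].
Proof.
have [L LL] := exists_layering R.
have [P [LP sepP covP]] := separated_covering_ext (layering_separated LL).
exists P, (disk_graph P); split=> //; first exact: covering_infinite.
split=> [p q _ _|]; first exact: graph_dist_ge.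
(* 1800 is 60 from [reach_main] times 30 from [powR_ln_rad_le]. *)
exists 1800 => p q Pp Pq d2.
have [n [m [n0 dn pqm mn]]] := reach_main LL LP covP Pp Pq d2.
apply: le_trans (graph_dist_le_reach pqm) _; rewrite lee_fin.
apply: le_trans mn _; rewrite lerD2l.
have n0' : 0 < n%:R :> R by rewrite ltr0n.
have l0 : 0 < ln (eucl_dist p q) `^ (2 / 3) by rewrite powR_gt0 // ln_gt0; lra.
rewrite !mulrA ler_pdivrMr // mulrAC ler_pdivlMr //.
have d1 : 1 <= eucl_dist p q by lra.
have h := powR_ln_rad_le n0 d1 dn.
have : eucl_dist p q * ln (eucl_dist p q) `^ (2 / 3) <=
    eucl_dist p q * (30 * n%:R) by rewrite ler_wpM2l // eucl_dist_ge0.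
lra.
Qed.
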